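(* (a) Let $n\ge1$. For $\sigma=\sigma_1\cdots\sigma_n\in S_n$ define $$\mathrm{stat}(\sigma)=\sum_{i:\,\sigma_i>i}(\sigma_i-i)+\sum_{i:\,\sigma_i\le i}(1-\sigma_i)+\#\{1\le i<j\le n:\ \sigma_i>\sigma_j>j\}+\#\{1\le i<j\le n:\ \sigma_i\le j\text{ and }\sigma_i<\sigma_j\}.$$ Then $(\mathrm{exc},\mathrm{stat})$ is jointly distributed with $(\mathrm{des},\mathrm{maj})$ on $S_n$, i.e. $$\sum_{\sigma\in S_n}p^{\mathrm{exc}(\sigma)}q^{\mathrm{stat}(\sigma)}=\sum_{\sigma\in S_n}p^{\mathrm{des}(\sigma)}q^{\mathrm{maj}(\sigma)}.$$ (b) Let $\mathbf v=(v_1,\dots,v_t)$ be a vector of nonnegative integers and $n=\sum_i v_i$. For $\sigma=\sigma_1\cdots\sigma_n\in M(\mathbf v)$ define $$\mathrm{statx}(\sigma)=\binom n2+\sum_{i:\,\sigma_i\le f_i(\mathbf v)}\Big(\#\{j: i<j\le n,\ \sigma_i>\sigma_j\}+\#\{m: m<i,\ m\le v_1+\cdots+v_{\sigma_i-1},\ \sigma_m<\sigma_i\}\Big)$$ $$+\sum_{i:\,\sigma_i>f_i(\mathbf v)}\#\{m: m<i,\ \sigma_m<\sigma_i\}-\sum_{i:\,\sigma_i>f_i(\mathbf v)}(i-1)-\sum_{i:\,\sigma_i\le f_i(\mathbf v)}\Big(n-i+\sum_{m<\sigma_i}v_m\Big).$$ Then $(\mathrm{exc},\mathrm{statx})$ is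 jointly distributed with $(\mathrm{des},\mathrm{maj})$ on $M(\mathbf v)$, i.e. $$\sum_{\sigma\in M(\mathbf v)}p^{\mathrm{exc}(\sigma)}q^{\mathrm{statx}(\sigma)}=\sum_{\sigma\in M(\mathbf v)}p^{\mathrm{des}(\sigma)}q^{\mathrm{maj}(\sigma)}.$$
   Context: $M(\mathbf v)$ is the set of permutations (linear arrangements) $\sigma_1\cdots\sigma_n$ of the multiset $\{1^{v_1}2^{v_2}\cdots t^{v_t}\}$ having $v_i$ copies of $i$; when $\mathbf v=(1,\dots,1)$ ($n$ ones) it is identified with $S_n$. $f(\mathbf v)=f_1(\mathbf v)\cdots f_n(\mathbf v)$ is the unique weakly increasing element of $M(\mathbf v)$. A descent of $\sigma$ is an index $i$, $1\le i<n$, with $\sigma_i>\sigma_{i+1}$; $\mathrm{des}(\sigma)$ is the number of descents and $\mathrm{maj}(\sigma)$ is the sum of the descents. $\mathrm{exc}(\sigma)$ is the number of indices $i$ with $\sigma_i>f_i(\mathbf v)$ (so for $\sigma\in S_n$, the number of $i$ with $\sigma_i>i$). *)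

(* Defs.v *)
From mathcomp Require Import all_boot all_order all_fingroup all_algebra.
Set Implicit Arguments.
Unset Strict Implicit.
Unset Printing Implicit Defensive.

Import GRing.Theory.
Local Open Scope ring_scope.

(* Positions 1..n and letters 1..t are encoded as 'I_n and 'I_t, so the
   position (or letter) i of the usual 1-based convention is the ordinal of
   value i - 1. Comparisons are unaffected by this shift; wherever the numerical
   value of a position or letter matters it is written i.+1. *)

(* Statistics are defined on functions 'I_n -> 'I_t, so that they apply both to
   permutations s : 'S_n and to words w : n.-tuple 'I_t (through tnth w). *)
Definition descents n t (w : 'I_n -> 'I_t) : {set 'I_n} :=
  [set i : 'I_n | [exists j : 'I_n, (val j == i.+1) && (w j < w i)%N]].

Definition des n t (w : 'I_n -> 'I_t) : nat := #|descents w|.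

Definition maj n t (w : 'I_n -> 'I_t) : nat :=
  (\sum_(i in descents w) i.+1)%N.

(* Excedances relative to the weakly increasing word f; for permutations f is
   the identity. *)
Definition exc n t (f w : 'I_n -> 'I_t) : nat := #|[set i | (f i < w i)%N]|.

Definition stat n (s : 'S_n) : int :=
  \sum_(i < n | (i < s i)%N) ((s i).+1%:Z - i.+1%:Z)
  + \sum_(i < n | (s i <= i)%N) (1 - (s i).+1%:Z)
  + #|[set ij : 'I_n * 'I_n |
        [&& ij.1 < ij.2, s ij.2 < s ij.1 & ij.2 < s ij.2]%N]|%:Z
  + #|[set ij : 'I_n * 'I_n |
        [&& ij.1 < ij.2, s ij.1 <= ij.2 & s ij.1 < s ij.2]%N]|%:Z.

Section Words.
Variables (t : nat) (v : 'I_t -> nat).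

Definition wsize : nat := (\sum_(k < t) v k)%N.

Definition words : {set wsize.-tuple 'I_t} :=
  [set w : wsize.-tuple 'I_t | [forall k, count_mem k w == v k]].

Definition before (k : 'I_t) : nat := (\sum_(l < t | (l < k)%N) v l)%N.

Lemma fword_subproof :
  size (flatten [seq nseq (v k) k | k <- enum 'I_t]) == wsize.
Proof.
rewrite size_flatten /shape -map_comp sumnE big_map big_enum /=.
by apply/eqP/eq_bigr => k _; rewrite size_nseq.
Qed.

Definition fword : wsize.-tuple 'I_t := Tuple fword_subproof.

Lemma fword_in_words : fword \in words.
Proof.
rewrite inE; apply/forallP => k; apply/eqP.
rewrite /= count_flatten -map_comp sumnE big_map big_enum /= (bigD1 k) //=.
rewrite count_nseq /= eqxx mul1n big1 ?addn0 // => l lk.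
by rewrite count_nseq /= (negbTE lk).
Qed.

Lemma fword_sorted : sorted (fun k l : 'I_t => (k <= l)%N) fword.
Proof.
have: sorted (fun k l : 'I_t => (k <= l)%N) (enum 'I_t).
  by have := iota_sorted 0 t; rewrite -val_enum_ord sorted_map.
rewrite /=; set le := (fun _ _ => _).
have le_tr : transitive le by move=> b a c; apply: leq_trans.
elim: (enum _) => //= a s IHs; rewrite (path_sortedE le_tr) => /andP[/allP as_ ss].
rewrite sorted_pairwise // pairwise_cat -!sorted_pairwise // IHs // andbT.
apply/andP; split.
  apply/allrelP => x y; rewrite mem_nseq => /andP[_ /eqP->].
  by move=> /flatten_mapP[b bs]; rewrite mem_nseq => /andP[_ /eqP->]; apply: as_.
rewrite sorted_pairwise //; elim: (v a) => //= m ->; rewrite andbT.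
by apply/allP => x; rewrite mem_nseq => /andP[_ /eqP->]; apply: leqnn.
Qed.

Lemma fword_unique (w : wsize.-tuple 'I_t) :
  w \in words -> sorted (fun k l : 'I_t => (k <= l)%N) w -> w = fword.
Proof.
move=> wv w_sorted; apply/val_inj.
apply: (sorted_eq _ _ w_sorted fword_sorted).
- by move=> b a c; apply: leq_trans.
- by move=> a b /anti_leq/val_inj.
rewrite /perm_eq; apply/allP => k _ /=; apply/eqP.
move: wv fword_in_words; rewrite !inE => /forallP/(_ k)/eqP->.
by move=> /forallP/(_ k)/eqP->.
Qed.

Definition statx (w : wsize.-tuple 'I_t) : int :=
  let n := wsize in
  let s := tnth w in
  let f := tnth fword in
  'C(n, 2)%:Z
  + \sum_(i < n | (s i <= f i)%N)
      (#|[set j : 'I_n | (i < j)%N && (s j < s i)%N]|%:Z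
       + #|[set m : 'I_n |
             [&& m < i, m.+1 <= before (s i) & s m < s i]%N]|%:Z)
  + \sum_(i < n | (f i < s i)%N) #|[set m : 'I_n | (m < i)%N && (s m < s i)%N]|%:Z
  - \sum_(i < n | (f i < s i)%N) (i.+1%:Z - 1)
  - \sum_(i < n | (s i <= f i)%N) (n%:Z - i.+1%:Z + (before (s i))%:Z).

End Words.

Lemma fword_ones n : fword (fun _ : 'I_n => 1%N) = enum 'I_n :> seq 'I_n.
Proof. by rewrite /=; elim: (enum _) => //= k s ->. Qed.

Definition jointly_distributed (T : finType) (A : {set T})
    (x : T -> nat) (y : T -> int) (x' : T -> nat) (y' : T -> int) : Prop :=
  forall (k : nat) (m : int),
    #|[set s in A | (x s == k) && (y s == m)]| =
    #|[set s in A | (x' s == k) && (y' s == m)]|.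

(* Main.v *)
Require Import Defs.
From mathcomp Require Import all_boot all_order all_fingroup all_algebra.
From mathcomp Require Import ring zify.
Import GRing.Theory.
Local Open Scope ring_scope.

Set Implicit Arguments.
Unset Strict Implicit.
Unset Printing Implicit Defensive.

(* Write (y)_n for (1 - yq)...(1 - yq^n), and let n be the length of the words
   of M(v). Both pairs of statistics (d, m) satisfy MacMahon's identity
     sum_w q^m(w) (z q^(-d(w)))_n / (1)_n = prod_k (z)_(v_k) / (1)_(v_k)
   for all z = q^x. As (q^(x-d))_n vanishes for x < d <= x + n, these identities
   form a triangular system, which determines the distribution of (d, m).

   On both sides the relation (yq)_n = q^n (y)_n + (1 - q^n) (yq)_(n-1) takes one
   letter off the word. For (des, maj) the last letter is removed, and the sums
   telescope over its value. For (exc, statx), write statx = C(n,2) - sum_i c_i,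
   where c_i is the number of positions m with w_m >= w_i that precede i in a
   linear order depending only on the letter w_i. Removing a copy of the smallest
   letter, at position i, lowers by one the excedance threshold of every letter
   whose threshold exceeds i. So the identity is proved for arbitrary thresholds
   b_1 <= ... <= b_n <= n of the letters, where the numerator on the right becomes
   prod_j (1 - z q^(j - b_j)), and the sum over i telescopes.

   For permutations, stat(s) = n exc(s) - statx(s), and reverse-complementation
   turns (des, maj) into (des, n des - maj). *)

(** * Inserting a letter into a word *)

Definition ins (i a : nat) (u : seq nat) := take i u ++ a :: drop i u.

Lemma size_ins i a u : size (ins i a u) = (size u).+1.
Proof. by rewrite size_cat /= addnS -size_cat cat_take_drop. Qed.

Lemma nth_ins i a u : (i <= size u)%N -> nth 0%N (ins i a u) i = a.
Proof. by move=> iu; rewrite nth_cat size_takel // ltnn subnn. Qed.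

Lemma nth_ins_bump i a u j :
  (i <= size u)%N -> nth 0%N (ins i a u) (bump i j) = nth 0%N u j.
Proof.
move=> iu; rewrite /bump nth_cat size_takel //; case: (leqP i j) => ij.
  by rewrite add1n ltnNge (leq_trans ij) //= subSn //= nth_drop subnKC.
by rewrite add0n ij nth_take.
Qed.

Lemma perm_ins i a u : perm_eq (ins i a u) (a :: u).
Proof. by rewrite /ins perm_catC /= perm_cons perm_catC cat_take_drop. Qed.

Lemma ins_inj i a : {in [pred u | i <= size u]%N &, injective (ins i a)}.
Proof.
move=> u v /= iu iv /eqP; rewrite eqseq_cat ?size_takel // eqseq_cons eqxx /=.
by case/andP=> /eqP e1 /eqP e2; rewrite -[u](cat_take_drop i) e1 e2 cat_take_drop.
Qed.

Lemma ins_nth i w : (i < size w)%N -> ins i (nth 0%N w i) (take i w ++ drop i.+1 w) = w.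
Proof.
move=> iw; have si : size (take i w) = i by rewrite size_takel // ltnW.
rewrite /ins take_size_cat // drop_size_cat //.
by rewrite -drop_nth // cat_take_drop.
Qed.

(** [ins i a] is a bijection from the arrangements of [s] onto those of [a :: s] with [a] at
    position [i]. Both recursions take off a letter in this way. *)
Lemma sum_permutations_nth (V : nmodType) a s i (H : seq nat -> V) :
  (i <= size s)%N ->
  \sum_(w <- permutations (a :: s) | nth 0%N w i == a) H w =
  \sum_(u <- permutations s) H (ins i a u).
Proof.
move=> is_; rewrite -big_filter -(big_map (ins i a) xpredT).
apply/perm_big/uniq_perm.
- exact/filter_uniq/permutations_uniq.
- rewrite map_inj_in_uniq ?permutations_uniq // => u v.
  rewrite !mem_permutations => /perm_size su /perm_size sv.
  by apply: ins_inj; rewrite inE ?su ?sv.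
move=> w; rewrite mem_filter mem_permutations; apply/andP/mapP => [[/eqP wi wp]|].
  have iw : (i < size w)%N by rewrite (perm_size wp).
  have wE : w = ins i a (take i w ++ drop i.+1 w) by rewrite -{1}wi ins_nth.
  exists (take i w ++ drop i.+1 w) => //; rewrite mem_permutations -(perm_cons a).
  by rewrite -(permPr wp) perm_sym {1}wE perm_ins.
case=> u; rewrite mem_permutations => up ->.
rewrite nth_ins ?(perm_size up) //; split=> //.
by rewrite (permPl (perm_ins _ _ _)) perm_cons.
Qed.

(** * Descents and major index *)

Definition desq (w : seq nat) : nat :=
  \sum_(0 <= i < (size w).-1) (nth 0 w i.+1 < nth 0 w i)%N.

Definition majq (w : seq nat) : nat :=
  \sum_(0 <= i < (size w).-1) (nth 0 w i.+1 < nth 0 w i)%N * i.+1.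

(** Tells whether an end marker placed between the letters [c - 1] and [c] would create a descent
    after [w]. *)
Definition last_ge c (w : seq nat) := (w != [::]) && (c <= last 0 w)%N.

Lemma desq_rcons u a : desq (rcons u a) = (desq u + last_ge a.+1 u)%N.
Proof.
rewrite /desq size_rcons /=; case/lastP: u => [|u c]; first by rewrite !big_geq.
have E j : (j <= size u)%N -> nth 0%N (rcons (rcons u c) a) j = nth 0%N (rcons u c) j.
  by move=> ju; rewrite nth_rcons size_rcons ltnS ju.
rewrite size_rcons big_nat_recr //= /last_ge last_rcons.
rewrite !nth_rcons !size_rcons ltnSn ltnn eqxx ltnn eqxx.
have -> : rcons u c != [::] by case: (u).
congr (_ + _)%N; apply: eq_big_nat => i /andP[_ iu].
by rewrite !E // ltnW.
Qed.

Lemma majq_rcons u a : majq (rcons u a) = (majq u + last_ge a.+1 u * size u)%N.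
Proof.
rewrite /majq size_rcons /=; case/lastP: u => [|u c]; first by rewrite !big_geq.
have E j : (j <= size u)%N -> nth 0%N (rcons (rcons u c) a) j = nth 0%N (rcons u c) j.
  by move=> ju; rewrite nth_rcons size_rcons ltnS ju.
rewrite size_rcons big_nat_recr //= /last_ge last_rcons.
rewrite !nth_rcons !size_rcons ltnSn ltnn eqxx ltnn eqxx.
have -> : rcons u c != [::] by case: (u).
congr (_ + _)%N; apply: eq_big_nat => i /andP[_ iu].
by rewrite !E // ltnW.
Qed.

Lemma desq_lt w : w != [::] -> (desq w < size w)%N.
Proof.
case: w => // a w _; rewrite ltnS /desq /= -[leqRHS]subn0 -[leqRHS]muln1.
by rewrite -sum_nat_const_nat leq_sum // => i _; case: leqP.
Qed.

(** * Products over the copies of each letter *)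

Section Products.
Variables (R : comNzRingType) (t : nat).
Implicit Types (g : nat -> nat -> R) (s : seq nat).

Definition mprod g s : R := \prod_(k < t) \prod_(l < count_mem (k : nat) s) g k l.

Lemma mprod_perm g s1 s2 : perm_eq s1 s2 -> mprod g s1 = mprod g s2.
Proof. by move=> /seq.permP e; apply: eq_bigr => k _; rewrite e. Qed.

Lemma mprod_nil g : mprod g [::] = 1.
Proof. by apply: big1 => k _; rewrite big_ord0. Qed.

Lemma mprod_cons g a s : (a < t)%N ->
  mprod g (a :: s) = g a (count_mem a s) * mprod g s.
Proof.
move=> lt_at; pose a' := Ordinal lt_at.
rewrite /mprod (bigD1 a') //= [X in _ = _ * X](bigD1 a') //= eqxx add1n.
rewrite big_ord_recr /= mulrA [g _ _ * _]mulrC; congr (_ * _).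
by apply: eq_bigr => k /negbTE ka; rewrite -[a]/(val a') eq_sym val_eqE ka.
Qed.

Lemma eq_mprod g1 g2 s : (forall k l, (k < t)%N -> g1 k l = g2 k l) ->
  mprod g1 s = mprod g2 s.
Proof. by move=> e; apply: eq_bigr => k _; apply: eq_bigr => l _; apply: e. Qed.

End Products.

(** * The finite products [(y)_n] *)

Section QSeries.
Variables (F : fieldType) (q : F).

Definition qpoch n y : F := \prod_(l < n) (1 - y * q ^+ l.+1).

Lemma qpoch0 y : qpoch 0 y = 1. Proof. exact: big_ord0. Qed.

Lemma qpochSr n y : qpoch n.+1 y = qpoch n y * (1 - y * q ^+ n.+1).
Proof. exact: big_ord_recr. Qed.

Lemma qpochSl n y : qpoch n.+1 y = (1 - y * q) * qpoch n (y * q).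
Proof.
rewrite /qpoch big_ord_recl; congr (_ * _); apply: eq_bigr => l _.
by rewrite [q ^+ (bump _ _).+1]exprS mulrA.
Qed.

(* In qpoch n.+1 (y * q) - q ^+ n.+1 * qpoch n.+1 y the two extreme factors cancel:
   this is how one letter is taken off a word. *)
Lemma qpoch_shift n y :
  qpoch n.+1 (y * q) = q ^+ n.+1 * qpoch n.+1 y + (1 - q ^+ n.+1) * qpoch n (y * q).
Proof. rewrite qpochSr qpochSl; ring. Qed.

Hypothesis q_neq0 : q != 0.

Lemma qpoch_eq0 n x e : (x < e <= x + n)%N -> qpoch n (q ^+ x / q ^+ e) = 0.
Proof.
move=> /andP[xe en]; have ln : (e - x.+1 < n)%N by lia.
apply/eqP/prodf_eq0; exists (Ordinal ln) => //=; rewrite subnSK //.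
by rewrite subr_eq0 eq_sym mulrAC -exprD subnKC ?divff ?expf_neq0 // ltnW.
Qed.

Lemma qpoch1_neq0 n : (forall k, (0 < k)%N -> q ^+ k != 1) -> qpoch n 1 != 0.
Proof.
move=> q1; apply/prodf_neq0 => l _.
by rewrite mul1r subr_eq0 eq_sym q1.
Qed.

End QSeries.

(** * MacMahon's identity for descents and major index *)

Section DescentSide.
Variables (F : fieldType) (q : F) (t : nat).
Hypothesis q_neq0 : q != 0.
Implicit Types (s u w : seq nat) (z : F).

(** The weight of [w] followed by its end marker. Marker [0] adds a descent to every nonempty word.
    A marker above all letters adds none and gives the weight of (des, maj). *)
Definition desmaj_wt c z w : F :=
  q ^+ (majq w + last_ge c w * size w)
  * qpoch q (size w) (z / q ^+ (desq w + last_ge c w)).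

Definition desmaj_sum c z s : F := \sum_(w <- permutations s) desmaj_wt c z w.

(** At [c = t] this is the numerator of MacMahon's product. The letters from [c] on have [z / q] in
    place of [z], up to a power of [q], so raising [c] by one changes a single block. *)
Definition letter_prod c z s : F :=
  mprod t (fun k l => (if (k < c)%N then 1 else q) - z * q ^+ l.+1) s.

(** The markers [c.+1] and [c] differ only by the descent after the last letter [c]. The difference
    is thus an instance of [qpoch_shift]. *)
Lemma desmaj_wt_rcons c z u :
  desmaj_wt c.+1 z (rcons u c) - desmaj_wt c z (rcons u c)
  = (1 - q ^+ (size u).+1) * desmaj_wt c.+1 z u.
Proof.
have r0 : rcons u c != [::] by case: (u).
have l0 : last_ge c.+1 (rcons u c) = false by rewrite /last_ge last_rcons ltnn andbF.
have l1 : last_ge c (rcons u c) by rewrite /last_ge last_rcons leqnn r0.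
rewrite /desmaj_wt size_rcons desq_rcons majq_rcons l0 l1.
rewrite !mul0n !addn0 mul1n addn1; move: (desq u + _)%N => e; rewrite !exprD.
have zE : z / q ^+ e = z / q ^+ e.+1 * q.
  by rewrite exprSr invfM mulrA divfK.
rewrite zE qpoch_shift [q ^+ (size u).+1]exprS; ring.
Qed.

(** Words not ending in [c] weigh the same with either marker and cancel; the others lose their last
    letter. *)
Lemma desmaj_sum_step c z s : s != [::] ->
  desmaj_sum c.+1 z s - desmaj_sum c z s =
  if c \in s then (1 - q ^+ size s) * desmaj_sum c.+1 z (rem c s) else 0.
Proof.
move=> s0; rewrite /desmaj_sum -sumrB.
rewrite (bigID (fun w => nth 0%N w (size s).-1 == c)) /= [X in _ + X]big1_seq.
  rewrite addr0; case: ifPn => cs.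
    have sE : size s = (size (rem c s)).+1 by rewrite (perm_size (perm_to_rem cs)).
    rewrite (perm_big _ (perm_permutations (perm_to_rem cs))) sE /=.
    rewrite sum_permutations_nth // big_distrr /=; apply: eq_big_seq => u.
    rewrite mem_permutations => /perm_size su.
    by rewrite /ins -su take_size drop_size cats1 desmaj_wt_rcons.
  rewrite big1_seq // => w /andP[/eqP wc]; rewrite mem_permutations => wp.
  case/negP: cs; rewrite -(perm_mem wp) -wc -(perm_size wp).
  by rewrite mem_nth // ltn_predL (perm_size wp); case: (s) s0.
move=> w /andP[wc]; rewrite mem_permutations => /perm_size ws.
by rewrite /desmaj_wt /last_ge -nth_last ws [(c < _)%N]ltn_neqAle [c == _]eq_sym wc subrr.
Qed.

(** Since [q - z q^(l+1) = q (1 - z q^l)], the two products share all factors but the extreme ones,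
    as in [qpoch_shift]. *)
Lemma letter_block_step z m :
  \prod_(l < m) (1 - z * q ^+ l.+1) - \prod_(l < m) (q - z * q ^+ l.+1)
  = (1 - q ^+ m) * \prod_(l < m.-1) (1 - z * q ^+ l.+1).
Proof.
case: m => [|m]; first by rewrite !big_ord0 expr0; ring.
have -> : \prod_(l < m.+1) (q - z * q ^+ l.+1)
       = q ^+ m.+1 * ((1 - z) * \prod_(l < m) (1 - z * q ^+ l.+1)).
  transitivity (\prod_(l < m.+1) (q * (1 - z * q ^+ l))).
    by apply: eq_bigr => l _; rewrite exprS; ring.
  rewrite big_split /= big_const_ord iter_mulr_1 big_ord_recl /= expr0 mulr1.
  by congr (_ * (_ * _)); apply: eq_bigr.
by rewrite big_ord_recr /= exprS; ring.
Qed.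

Lemma letter_prod_step c z s : (c < t)%N ->
  letter_prod c.+1 z s - letter_prod c z s =
  if c \in s then (1 - q ^+ count_mem c s) * letter_prod c.+1 z (rem c s) else 0.
Proof.
move=> ct; pose c' := Ordinal ct; rewrite /letter_prod /mprod.
have other (k : 'I_t) : k != c' -> (k < c.+1)%N = (k < c)%N.
  by rewrite -val_eqE /= ltnS [in RHS]ltn_neqAle => ->.
rewrite (bigD1 c') //= [X in _ - X](bigD1 c') //= ltnSn ltnn.
set P := \prod_(k < t | _) _; set P' := \prod_(k < t | _) _.
have -> : P' = P.
  by apply: eq_bigr => k kc; apply: eq_bigr => l _; rewrite other.
rewrite -mulrBl letter_block_step; case: ifPn => [cs|/count_memPn->]; last first.
  by rewrite expr0 subrr !mul0r.
rewrite -mulrA; congr (_ * _); rewrite [RHS](bigD1 c') //= ltnSn count_mem_rem eqxx subn1.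
congr (_ * _); apply: eq_bigr => k kc.
by rewrite count_mem_rem -[c]/(val c') val_eqE eq_sym (negbTE kc) subn0.
Qed.

Definition letter_qfact s : F := mprod t (fun _ l => 1 - q ^+ l.+1) s.

Lemma letter_qfact_rem c s : (c < t)%N -> c \in s ->
  letter_qfact s = (1 - q ^+ count_mem c s) * letter_qfact (rem c s).
Proof.
move=> ct cs; rewrite /letter_qfact (mprod_perm _ _ (perm_to_rem cs)) mprod_cons //.
by rewrite count_mem_rem eqxx subn1 prednK // -has_count has_pred1.
Qed.

(** Marker [0] adds a descent to every arrangement and marker [t] to none. The factor [q] in [z * q]
    offsets this descent in [qpoch], and [q ^+ size s] is its share of the major index. *)
Lemma desmaj_sum_shift z s : s != [::] -> all (gtn t) s ->
  desmaj_sum 0 (z * q) s = q ^+ size s * desmaj_sum t z s.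
Proof.
move=> s0 st; rewrite /desmaj_sum big_distrr /=; apply: eq_big_seq => w.
rewrite mem_permutations => wp; rewrite /desmaj_wt /last_ge (perm_size wp).
have w0 : w != [::] by rewrite -size_eq0 (perm_size wp) size_eq0.
have wt : (last 0%N w < t)%N.
  have /allP : all (gtn t) w by rewrite (perm_all _ wp).
  by apply; case: (w) w0 => // a v _; rewrite /= mem_last.
rewrite w0 [(t <= _)%N]leqNgt wt /= mul0n mul1n !addn0 addn1 exprSr.
by rewrite -mulf_div divff // mulr1 exprD; ring.
Qed.

Lemma letter_prod_shift z s : all (gtn t) s ->
  letter_prod 0 (z * q) s = q ^+ size s * letter_prod t z s.
Proof.
elim: s => [|a s IHs] /=; first by rewrite /letter_prod !mprod_nil mulr1.
case/andP=> at_ st; have := IHs st; rewrite /letter_prod !mprod_cons // at_ => ->.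
by rewrite ltn0 !exprS; ring.
Qed.

(* The difference K of the two sides does not depend on c, whence
   K (z * q) = q ^+ n * K z by the two shift lemmas; moreover K 1 = 0. *)
Lemma desmaj_sum_prod s c x : all (gtn t) s -> (c <= t)%N ->
  desmaj_sum c (q ^+ x) s * letter_qfact s
  = qpoch q (size s) 1 * letter_prod c (q ^+ x) s.
Proof.
have [n] := ubnP (size s); elim: n s c x => // n IHn s c x.
case: (altP (s =P [::])) => [-> _ _ _|s0 sn st ct].
  rewrite /desmaj_sum /letter_qfact /letter_prod !mprod_nil /= big_seq1.
  by rewrite /desmaj_wt /= !qpoch0 /majq big_geq // !mulr1.
pose K c y := desmaj_sum c (q ^+ y) s * letter_qfact s
              - qpoch q (size s) 1 * letter_prod c (q ^+ y) s.
(* Both sides obey the same recursion in [d], so the increment of [K] is a multiple of the induction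
   hypothesis for [rem d s]. *)
have Kstep d y : (d < t)%N -> K d.+1 y = K d y.
  move=> dt; apply/eqP; rewrite -subr_eq0; apply/eqP.
  transitivity ((desmaj_sum d.+1 (q ^+ y) s - desmaj_sum d (q ^+ y) s) * letter_qfact s
    - qpoch q (size s) 1 * (letter_prod d.+1 (q ^+ y) s - letter_prod d (q ^+ y) s)).
    by rewrite /K; ring.
  rewrite desmaj_sum_step // letter_prod_step //; case: ifP => [ds|_]; last ring.
  have sE := perm_size (perm_to_rem ds); rewrite /= in sE.
  have rt : all (gtn t) (rem d s).
    by apply/allP => a /mem_rem; apply: (allP st).
  have := IHn (rem d s) d.+1 y _ rt dt; rewrite -ltnS -sE => /(_ sn) IH.
  rewrite (letter_qfact_rem dt ds) sE qpochSr mul1r.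
  transitivity ((1 - q ^+ (size (rem d s)).+1) * (1 - q ^+ count_mem d s)
    * (desmaj_sum d.+1 (q ^+ y) (rem d s) * letter_qfact (rem d s)
       - qpoch q (size (rem d s)) 1 * letter_prod d.+1 (q ^+ y) (rem d s))); first ring.
  by rewrite IH subrr mulr0.
have K0 d y : (d <= t)%N -> K d y = K 0%N y.
  by elim: d => // d IHd dt; rewrite Kstep // IHd // ltnW.
suff Kx : K 0%N x = 0 by apply/eqP; rewrite -subr_eq0 -/(K c x) K0 // Kx.
elim: (x) => [|y IHy].
  (* At [z = 1] and marker [0] each word has between 1 and [size s] descents, so its weight
     vanishes; the product contains the factor [q - q]. *)
  rewrite /K {1}/desmaj_sum big1_seq ?mul0r ?sub0r => [|w /andP[_]].
    have [a as_] : exists a, a \in s by case: (s) s0 => // a v _; exists a; rewrite mem_head.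
    have a_t : (a < t)%N := allP st a as_.
    have ca : (0 < count_mem a s)%N by rewrite -has_count has_pred1.
    apply/eqP; rewrite oppr_eq0 mulf_eq0; apply/orP; right.
    apply/prodf_eq0; exists (Ordinal a_t) => //=.
    by apply/prodf_eq0; exists (Ordinal ca) => //=; rewrite expr0 mul1r expr1 subrr.
  rewrite mem_permutations => wp; rewrite /desmaj_wt.
  have w0 : w != [::] by rewrite -size_eq0 (perm_size wp) size_eq0.
  by rewrite qpoch_eq0 ?mulr0 // /last_ge w0 /= addn1 ltnS desq_lt.
rewrite /K exprSr desmaj_sum_shift // letter_prod_shift //.
by transitivity (q ^+ size s * K t y); [rewrite /K; ring | rewrite K0 // IHy mulr0].
Qed.

End DescentSide.

(** * Excedances with respect to arbitrary thresholds *)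

(* The positions, in the order that ranks them for a letter whose excedance
   threshold is B: first 0, ..., B - 1, then n - 1, ..., B (downwards). *)
Definition prec B m i :=
  ((i < B) && (m < i) || (B <= i) && ((m < B) || (i < m)))%N.

Definition prec_rank B n i := (if i < B then i else B + (n - i.+1))%N.

Definition cinv (b : nat -> nat) (w : seq nat) : nat :=
  \sum_(i < size w) \sum_(m < size w)
    (prec (b (nth 0 w i)) m i && (nth 0 w i <= nth 0 w m))%N.

(** These are the excedances when [b k] is the number of letters smaller than [k]. *)
Definition hits (b : nat -> nat) (w : seq nat) : nat :=
  \sum_(i < size w) (i < b (nth 0 w i))%N.

(** The threshold [B] after deletion of position [i]. *)
Definition drop_pos i B := (B - (i < B))%N.

Definition copies_after B w i : nat :=
  \sum_(m < size w) ((nth 0 w m == nth 0 w i) && prec B i m)%N.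

Lemma hits_le b w : (hits b w <= size w)%N.
Proof.
rewrite -[leqRHS]card_ord -sum1_card leq_sum // => i _.
by case: (_ < _)%N.
Qed.

Lemma hits_ins b i a u : (i <= size u)%N ->
  hits b (ins i a u) = ((i < b a) + hits (drop_pos i \o b) u)%N.
Proof.
move=> iu; pose i' := Ordinal (iu : (i < (size u).+1)%N).
rewrite /hits size_ins (bigD1_ord i') //= nth_ins //; congr (_ + _)%N.
apply: eq_bigr => j _; rewrite nth_ins_bump //= /drop_pos /bump.
by congr nat_of_bool; lia.
Qed.

Lemma prec_count B n i : (i < n)%N -> (B <= n)%N ->
  (\sum_(m < n) prec B m i = prec_rank B n i)%N.
Proof.
have H k : (\sum_(m < k) prec B m i =
    if i < B then minn k i else minn k B + (k - i.+1))%N.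
  elim: k => [|k IHk]; first by rewrite big_ord0 !min0n if_same.
  by rewrite big_ord_recr /= IHk /prec; case: ifP; lia.
by rewrite H /prec_rank; case: ifP; lia.
Qed.

(** As [a] is minimal, all predecessors of [i] count against it, which gives its rank, while [a]
    itself counts only against the copies of [a] ranked after it. Deleting position [i] turns the
    order for [B] into the order for [drop_pos i B]. *)
Lemma cinv_ins b i a u : (i <= size u)%N -> all (leq a) u -> (b a <= (size u).+1)%N ->
  cinv b (ins i a u) = (prec_rank (b a) (size u).+1 i
    + copies_after (b a) (ins i a u) i + cinv (drop_pos i \o b) u)%N.
Proof.
move=> iu au bN; pose i' := Ordinal (iu : (i < (size u).+1)%N).
have a_le j : (j < size u)%N -> (a <= nth 0 u j)%N by move=> ju; apply/(allP au)/mem_nth.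
rewrite /cinv size_ins (bigD1_ord i') //= nth_ins // -addnA; congr (_ + _)%N.
  rewrite -(prec_count _ bN) //; apply: eq_bigr => m _.
  case: (unliftP i' m) => [k ->|->] /=; last by rewrite nth_ins // leqnn andbT.
  by rewrite nth_ins_bump // a_le // andbT.
rewrite /copies_after size_ins (bigD1_ord i') //= nth_ins //.
have -> : prec (b a) i i = false by rewrite /prec; lia.
rewrite andbF add0n -big_split /=; apply: eq_bigr => j _.
rewrite (bigD1_ord i') //= nth_ins_bump // nth_ins //; congr (_ + _)%N.
  rewrite andbC; case: (altP (nth 0%N u j =P a)) => [->|ja]; first by rewrite leqnn.
  by rewrite leqNgt ltn_neqAle eq_sym ja a_le.
apply: eq_bigr => m _; rewrite nth_ins_bump //; congr (nat_of_bool (_ && _)).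
by rewrite /prec /drop_pos /bump; lia.
Qed.

(** * Removing the smallest letter, and telescoping over its position *)

Section ExcedanceSide.
Variables (F : fieldType) (q : F).

(** In decreasing order the exponents are 0, 1, ..., [size A - 1], so the sum is geometric. *)
Lemma sum_count_gt (A : seq nat) : uniq A ->
  (1 - q) * \sum_(x <- A) q ^+ count (ltn x) A = 1 - q ^+ size A.
Proof.
move=> uA; have pA : perm_eq (sort geq A) A by rewrite perm_sort.
rewrite -(perm_size pA) -(perm_big _ pA) /=.
under eq_bigr => x _ do rewrite -(seq.permP pA).
have: sorted gtn (sort geq A).
  rewrite sorted_pairwise; last by move=> x y z; rewrite /gtn /=; lia.
  have := sort_sorted (fun x y => leq_total y x : geq x y || geq y x) A.
  rewrite sorted_pairwise; last by move=> x y z; rewrite /geq /=; lia.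
  have: uniq (sort geq A) by rewrite sort_uniq.
  elim: (sort _ _) => //= x s IHs /andP[xs us] /andP[/allP sx ss].
  rewrite IHs // andbT; apply/allP => y ys; have := sx y ys.
  rewrite /geq /gtn /= leq_eqVlt => /predU1P[yx|//].
  by rewrite -yx ys in xs.
elim: (sort _ _) => [_|x s IHs] /=; first by rewrite big_nil expr0; ring.
move=> xs; have tr : transitive gtn by move=> ? ? ?; rewrite /gtn /=; lia.
have sx : all (gtn x) s by apply: order_path_min xs.
have cx : count (ltn x) s = 0%N.
  apply/eqP; rewrite -leqn0 leqNgt -has_count; apply/hasPn => y /(allP sx) /=.
  by rewrite -leqNgt => /ltnW.
rewrite big_cons ltnn cx expr0 mulrDr.
rewrite (eq_big_seq (fun y => q * q ^+ count (ltn y) s)) => [|y ys].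
  by rewrite -big_distrr /= mulrCA IHs ?(path_sorted xs) // exprS; ring.
by have /= -> := allP sx y ys; rewrite add1n exprS.
Qed.

Lemma prec_rankE B n i m : (i < n)%N -> (m < n)%N -> (B <= n)%N ->
  prec B i m = (prec_rank B n i < prec_rank B n m)%N.
Proof.
by move=> ? ? ?; rewrite /prec /prec_rank; do 2!case: ifP; lia.
Qed.

Lemma sum_copies_after B a w : (B <= size w)%N ->
  (1 - q) * \sum_(i < size w | nth 0%N w i == a) q ^+ copies_after B w i
  = 1 - q ^+ count_mem a w.
Proof.
move=> Bn; pose I := [seq i <- iota 0 (size w) | nth 0%N w i == a].
pose A := map (prec_rank B (size w)) I.
have uA : uniq A.
  rewrite map_inj_in_uniq ?filter_uniq ?iota_uniq // => i m.
  rewrite !mem_filter !mem_iota /= !add0n => /andP[_ iw] /andP[_ mw].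
  by rewrite /prec_rank; do 2!case: ifP; lia.
have sA : size A = count_mem a w.
  by rewrite size_map size_filter -[in RHS](mkseq_nth 0%N w) count_map.
rewrite -sA -sum_count_gt // big_map big_filter.
have iE : iota 0 (size w) = index_iota 0 (size w) by rewrite /index_iota subn0.
rewrite iE big_mkord; congr (_ * _).
apply: eq_bigr => i /eqP wi; congr (_ ^+ _); rewrite /copies_after count_map.
rewrite count_filter -sum1_count iE big_mkord [RHS]big_mkcond.
by apply: eq_bigr => m _; rewrite wi /= andbC -prec_rankE //; case: (_ && _).
Qed.

(** One copy of [a] is marked in each word, with weight [q ^+ copies_after]; [sum_copies_after]
    evaluates the total weight of the marks. This weight cancels the term [copies_after] of
    [cinv_ins], so removing the marked letter leaves only its rank. *)
Lemma sum_cinv_cons b a s (g : nat -> F) :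
  q != 0 -> all (leq a) s -> (b a <= (size s).+1)%N ->
  (1 - q ^+ (count_mem a s).+1)
    * \sum_(w <- permutations (a :: s)) g (hits b w) / q ^+ cinv b w
  = (1 - q) * \sum_(i < (size s).+1) (\sum_(u <- permutations s)
      g ((i < b a) + hits (drop_pos i \o b) u)%N / q ^+ cinv (drop_pos i \o b) u)
      / q ^+ prec_rank (b a) (size s).+1 i.
Proof.
move=> q0 sa bN; rewrite big_distrr /=.
rewrite (eq_big_seq (fun w => (1 - q) * \sum_(i < (size s).+1 | nth 0%N w i == a)
  q ^+ copies_after (b a) w i * (g (hits b w) / q ^+ cinv b w))); last first.
  move=> w; rewrite mem_permutations => wp; have /= ws := perm_size wp.
  have <- : count_mem a w = (count_mem a s).+1 by rewrite (seq.permP wp) /= eqxx.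
  by rewrite -big_distrl /= [RHS]mulrA -ws sum_copies_after ?ws.
rewrite -big_distrr /=; congr (_ * _); rewrite (exchange_big_dep xpredT) //=.
apply: eq_bigr => i _; rewrite sum_permutations_nth ?big_distrl /=; last by rewrite -ltnS.
apply: eq_big_seq => u; rewrite mem_permutations => up; have us := perm_size up.
have is_ : (i <= size s)%N by rewrite -ltnS.
have iu : (i <= size u)%N by rewrite us.
rewrite hits_ins // cinv_ins ?us //; last by rewrite (perm_all _ up).
by rewrite !exprD; field; rewrite !expf_neq0.
Qed.

(** The product of [1 - y q^(j - B_j)], with [j] counted from 0. *)
Fixpoint board_prod (y : F) (bs : seq nat) : F :=
  if bs is B :: bs' then (1 - y / q ^+ B) * board_prod (y * q) bs' else 1.

Hypothesis q_neq0 : q != 0.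

Lemma board_prod_drop y i bs : all (ltn i) bs ->
  board_prod y (map (drop_pos i) bs) = board_prod (y * q) bs.
Proof.
elim: bs y => //= B bs IHbs y /andP[iB /IHbs->]; congr (_ * _).
rewrite /drop_pos iB; case: B iB => // B _; rewrite subn1 /= exprSr.
by rewrite -mulf_div divff // mulr1.
Qed.

Lemma geom_range lo hi : (lo <= hi)%N ->
  (q - 1) * \sum_(lo <= i < hi) q ^+ i = q ^+ hi - q ^+ lo.
Proof.
move=> lh; rewrite big_distrr /= -(telescope_sumr (fun i => q ^+ i)) //.
by apply: eq_bigr => i _; rewrite exprS; ring.
Qed.

(** Positions below the first threshold [B] lower all thresholds, so they contribute a constant
    product times a geometric sum. Positions from [B] on keep the first factor, and induction
    applies to the others with [y * q]. *)
Lemma board_telescope y lo hi bs : path leq lo bs -> all (geq hi) bs ->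
  (lo <= hi)%N ->
  (q - 1) * \sum_(lo <= i < hi) q ^+ i * board_prod y (map (drop_pos i) bs)
  = (q ^+ hi - y * q ^+ size bs) * board_prod y bs
    - (q ^+ lo - y) * board_prod (y * q) bs.
Proof.
elim: bs y lo => [|B bs IHbs] y lo /=.
  by move=> _ _ lh; under eq_bigr do rewrite mulr1; rewrite geom_range //; ring.
case/andP=> loB Bbs /andP[Bhi hbs] lh.
rewrite (big_cat_nat loB Bhi) /= mulrDr.
rewrite (_ : \sum_(lo <= i < B) _ = \sum_(lo <= i < B)
    q ^+ i * ((1 - y * q / q ^+ B) * board_prod (y * q * q) bs)); last first.
  apply: eq_big_nat => i /andP[_ iB]; congr (_ * _).
  apply: (board_prod_drop _ (bs := B :: bs)); rewrite /= iB /=.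
  have /allP H : all (leq B) bs by apply: order_path_min Bbs; apply: leq_trans.
  by apply/allP => C /H; apply: leq_trans.
rewrite -big_distrl mulrA geom_range //=.
rewrite (_ : \sum_(B <= i < hi) _ = \sum_(B <= i < hi)
    (1 - y / q ^+ B) * (q ^+ i * board_prod (y * q) (map (drop_pos i) bs))); last first.
  apply: eq_big_nat => i /andP[Bi _].
  by rewrite [drop_pos i B]/drop_pos ltnNge Bi subn0 mulrCA.
rewrite -big_distrr [(q - 1) * ((1 - y / _) * _)]mulrCA IHbs // exprS.
by field; rewrite expf_neq0.
Qed.

End ExcedanceSide.

(** * MacMahon's identity for excedances with thresholds *)

Section ExcedanceProduct.
Variables (F : fieldType) (q : F) (t : nat).
Hypothesis q_neq0 : q != 0.

Definition exc_sum b (g : nat -> F) s : F :=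
  \sum_(w <- permutations s) g (hits b w) / q ^+ cinv b w.

Lemma exc_sumD b g1 g2 c1 c2 s :
  exc_sum b (fun h => c1 * g1 h + c2 * g2 h) s
  = c1 * exc_sum b g1 s + c2 * exc_sum b g2 s.
Proof.
rewrite /exc_sum !big_distrr -big_split /=; apply: eq_bigr => w _; ring.
Qed.

Lemma eq_exc_sum b g1 g2 s : (forall h, (h <= size s)%N -> g1 h = g2 h) ->
  exc_sum b g1 s = exc_sum b g2 s.
Proof.
move=> e; apply: eq_big_seq => w; rewrite mem_permutations => /perm_size ws.
by rewrite e // -ws hits_le.
Qed.

Lemma exc_sumZ b g c s : exc_sum b (fun h => c * g h) s = c * exc_sum b g s.
Proof. by rewrite /exc_sum big_distrr; apply: eq_bigr => w _; rewrite /= mulrA. Qed.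

Lemma geom_inv B : (1 - q) * \sum_(0 <= i < B) (q ^+ i)^-1 = q * ((q ^+ B)^-1 - 1).
Proof.
elim: B => [|B IHB]; first by rewrite big_geq // expr0 invr1 subrr !mulr0.
by rewrite big_nat_recr //= mulrDr IHB exprS; field; rewrite q_neq0 expf_neq0.
Qed.

(** Once the first factor on the left is split off, both sides contain the same [qpoch q n]. It is
    zero for [h < n], and for [h = n] the remaining factors agree. *)
Lemma qpoch_boundary n h : (h <= n)%N ->
  qpoch q n.+1 (1 / q / q ^+ h.+1) = (1 - (q ^+ n.+1)^-1) * qpoch q n (1 / q / q ^+ h).
Proof.
move=> hn; rewrite qpochSl.
have -> : 1 / q / q ^+ h.+1 * q = (q ^+ h.+1)^-1.
  by rewrite exprS; field; rewrite q_neq0 expf_neq0.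
have -> : 1 / q / q ^+ h = (q ^+ h.+1)^-1.
  by rewrite exprS; field; rewrite q_neq0 expf_neq0.
move: hn; rewrite leq_eqVlt => /predU1P[->|hn]; first by [].
by rewrite -[(q ^+ h.+1)^-1]div1r -(expr0 q) qpoch_eq0 ?mulr0.
Qed.

(** Induction on the word, removing its smallest letter, with an inner induction on [x]. The
    division by [q] starts the latter at [z = 1 / q], where only words with a hit at every position
    can contribute. *)
Lemma exc_sum_prod s b x : sorted leq s -> all (gtn t) s ->
  {homo b : i j / (i <= j)%N} -> (forall k, (b k <= size s)%N) ->
  q ^+ 'C(size s, 2) * letter_qfact q t s
    * exc_sum b (fun h => qpoch q (size s) (q ^+ x / q / q ^+ h)) s
  = qpoch q (size s) 1 * board_prod q (q ^+ x) (map b s).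
Proof.
elim: s b x => [|a s IHs] b x /=.
  move=> _ _ _ _; rewrite /letter_qfact mprod_nil /exc_sum /= big_seq1 !qpoch0.
  by rewrite /cinv big_ord0 bin0n !expr0 divr1 !mulr1.
move=> ps /andP[a_t st] b_homo bN.
have sa : all (leq a) s by apply: order_path_min ps; apply: leq_trans.
have ss : sorted leq s := path_sorted ps.
set n := size s in IHs *.
have {}IHs i y : (i < n.+1)%N ->
    q ^+ 'C(n, 2) * letter_qfact q t s
      * exc_sum (drop_pos i \o b) (fun h => qpoch q n (q ^+ y / q / q ^+ h)) s
    = qpoch q n 1 * board_prod q (q ^+ y) (map (drop_pos i) (map b s)).
  move=> lt_in; rewrite -map_comp; apply: IHs => // [k1 k2 /b_homo|k] /=.
    by rewrite /drop_pos; lia.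
  by have := bN k; rewrite /drop_pos -/n; lia.
have step g : (1 - q ^+ (count_mem a s).+1) * exc_sum b g (a :: s)
    = (1 - q) * \sum_(0 <= i < n.+1)
        exc_sum (drop_pos i \o b) (fun h => g ((i < b a) + h)%N) s
        / q ^+ prec_rank (b a) n.+1 i.
  by rewrite big_mkord -sum_cinv_cons.
have Me : letter_qfact q t (a :: s) = (1 - q ^+ (count_mem a s).+1) * letter_qfact q t s.
  exact: mprod_cons.
have Ce : q ^+ 'C(n.+1, 2) = q ^+ n * q ^+ 'C(n, 2).
  by rewrite binS bin1 exprD mulrC.
have bsp : path leq (b a) (map b s).
  by rewrite path_map; apply: sub_path ps => k1 k2; apply: b_homo.
have bsn : all (geq n.+1) (map b s).
  by apply/allP => _ /mapP[k _ ->]; apply: bN.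
(* [b a] is the least threshold, so a position below it lowers all of them. *)
have low i y : (i < b a)%N ->
    board_prod q (q ^+ y) (map (drop_pos i) (map b s)) = board_prod q (q ^+ y.+1) (map b s).
  move=> ia; rewrite exprSr board_prod_drop //.
  have /allP H : all (leq (b a)) (map b s) by apply: order_path_min bsp; apply: leq_trans.
  by apply/allP => C /H; apply: leq_trans.
have {}step g : q ^+ 'C(n.+1, 2) * letter_qfact q t (a :: s) * exc_sum b g (a :: s)
    = q ^+ n * ((1 - q) * \sum_(0 <= i < n.+1) q ^+ 'C(n, 2) * letter_qfact q t s *
        exc_sum (drop_pos i \o b) (fun h => g ((i < b a) + h)%N) s
        / q ^+ prec_rank (b a) n.+1 i).
  transitivity (q ^+ n * (q ^+ 'C(n, 2) * letter_qfact q t s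
      * ((1 - q ^+ (count_mem a s).+1) * exc_sum b g (a :: s)))).
    by rewrite Me Ce; ring.
  rewrite step [X in q ^+ n * X]mulrCA; congr (_ * (_ * _)); rewrite big_distrr /=.
  by apply: eq_bigr => i _; rewrite mulrA.
have sum_low : q ^+ n * ((1 - q) * \sum_(0 <= i < b a) (q ^+ i)^-1)
    = q ^+ n.+1 * ((q ^+ b a)^-1 - 1).
  by rewrite geom_inv exprS; ring.
have QS : qpoch q n.+1 1 = qpoch q n 1 * (1 - q ^+ n.+1) by rewrite qpochSr mul1r.
elim: x => [|x IHx].
  rewrite step (big_cat_nat (leq0n _) (bN a)) /=.
  (* Here [a] is not a hit; the other letters give at most [n] hits, so the weight vanishes. *)
  rewrite (_ : \sum_(b a <= i < n.+1) _ = 0) ?addr0; last first.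
    rewrite big1_seq // => i; rewrite mem_index_iota => /andP[_ /andP[ai _]].
    rewrite (eq_exc_sum _ (g2 := fun h => 0 * 0)) ?exc_sumZ ?mul0r ?mulr0 ?mul0r // => h hn.
    rewrite ltnNge ai add0n ?mul0r expr0 mul1r -invfM -exprS.
    by rewrite -[(q ^+ h.+1)^-1]div1r -(expr0 q) qpoch_eq0.
  rewrite (_ : \sum_(0 <= i < b a) _ = \sum_(0 <= i < b a)
      (1 - (q ^+ n.+1)^-1) * (qpoch q n 1 * board_prod q q (map b s)) * (q ^+ i)^-1); last first.
    apply: eq_big_nat => i /andP[_ ia].
    rewrite (eq_exc_sum _ (g2 := fun h => (1 - (q ^+ n.+1)^-1)
      * qpoch q n (q ^+ 0 / q / q ^+ h))); last by move=> h hn; rewrite ia expr0 qpoch_boundary.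
    by rewrite exc_sumZ mulrCA IHs ?(leq_trans ia) // low // /prec_rank ia expr1.
  rewrite -big_distrr /= expr0 !mul1r.
  set K := (1 - q ^- n.+1) * _; set S := \sum_(0 <= i < b a) _ in sum_low *.
  transitivity (K * (q ^+ n * ((1 - q) * S))); first ring.
  rewrite sum_low QS /K; field; rewrite !expf_neq0 //.
(* The first term is known from [IHx]. The second has a [qpoch] of length [n], as required by the
   outer induction hypothesis once [a] is removed. *)
rewrite (eq_exc_sum _ (g2 := fun h => q ^+ n.+1 * qpoch q n.+1 (q ^+ x / q / q ^+ h)
    + (1 - q ^+ n.+1) * qpoch q n (q ^+ x.+1 / q / q ^+ h))); last first.
  move=> h _; suff -> : q ^+ x.+1 / q / q ^+ h = q ^+ x / q / q ^+ h * q.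
    exact: qpoch_shift.
  by rewrite exprS; field; rewrite q_neq0 expf_neq0.
rewrite exc_sumD mulrDr mulrCA IHx [X in _ + X]mulrCA step.
rewrite (big_cat_nat (leq0n _) (bN a)) /=.
(* The hit of [a] lowers [x.+1] to [x] and the dropped thresholds raise it back, so [i] enters only
   through the rank. *)
rewrite (_ : \sum_(0 <= i < b a) _ = \sum_(0 <= i < b a)
    (qpoch q n 1 * board_prod q (q ^+ x.+1) (map b s)) * (q ^+ i)^-1); last first.
  apply: eq_big_nat => i /andP[_ ia].
  rewrite (eq_exc_sum _ (g2 := fun h => qpoch q n (q ^+ x / q / q ^+ h))); last first.
    by move=> h _; rewrite ia add1n !exprS; congr qpoch; field; rewrite q_neq0 expf_neq0.
  by rewrite IHs ?(leq_trans ia) // low // /prec_rank ia.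
(* Without a hit [x.+1] stays. The rank contributes [q^(i - n - b a)], and the sum over [i] is the
   one in [board_telescope]. *)
rewrite (_ : \sum_(b a <= i < n.+1) _ = \sum_(b a <= i < n.+1)
    (qpoch q n 1 / q ^+ n / q ^+ b a)
    * (q ^+ i * board_prod q (q ^+ x.+1) (map (drop_pos i) (map b s)))); last first.
  apply: eq_big_nat => i /andP[ai lt_in].
  rewrite (eq_exc_sum _ (g2 := fun h => qpoch q n (q ^+ x.+1 / q / q ^+ h))); last first.
    by move=> h _; rewrite ltnNge ai.
  rewrite IHs // /prec_rank ltnNge ai subSS exprD.
  have -> : q ^+ n = q ^+ (n - i) * q ^+ i by rewrite -exprD subnK.
  by field; rewrite !expf_neq0.
rewrite -!big_distrr -[q ^+ x * q]exprSr /=.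
have := board_telescope q_neq0 (q ^+ x.+1) bsp bsn (bN a).
set S := \sum_(b a <= i < n.+1) _; set S' := \sum_(0 <= i < b a) _ in sum_low *.
rewrite size_map -/n => tel.
set B1 := board_prod q (q ^+ x.+1) _ in tel *.
set B2 := board_prod q (_ * q) _ in tel *.
transitivity (q ^+ n.+1 * (qpoch q n.+1 1 * ((1 - q ^+ x / q ^+ b a) * B1))
  + (1 - q ^+ n.+1) * qpoch q n 1 * (B1 * (q ^+ n * ((1 - q) * S'))
     - (q ^+ b a)^-1 * ((q - 1) * S))).
  by field; rewrite !expf_neq0.
by rewrite sum_low tel QS !exprS; field; rewrite !expf_neq0.
Qed.

End ExcedanceProduct.

(** In a sorted word, a position minus the number of smaller letters is the index of the copy, so
    the factors are those of MacMahon's product. *)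
Lemma board_prod_before (F : fieldType) (q y : F) t s :
  q != 0 -> sorted leq s -> all (gtn t) s ->
  board_prod q y (map (fun k => count (gtn k) s) s)
  = mprod t (fun _ l => 1 - y * q ^+ l) s.
Proof.
move=> q0; elim/last_ind: s => [|s a IHs]; first by rewrite mprod_nil.
rewrite all_rcons => sa /andP[a_t st].
have [ss sle] : sorted leq s /\ all (geq a) s.
  have tr : transitive leq by move=> ? ? ?; apply: leq_trans.
  move: sa; rewrite !sorted_pairwise // -cats1 pairwise_cat /= => /and3P[/allrelP H -> _].
  by split=> //; apply/allP => k ks; apply: H ks (mem_head _ _).
have board_rcons (z : F) bs B :
    board_prod q z (rcons bs B) = board_prod q z bs * (1 - z * q ^+ size bs / q ^+ B).
  elim: bs z => [|B' bs IHbs] z /=; first by rewrite expr0 mulr1; ring.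
  by rewrite IHbs exprS !mulrA.
have pr : perm_eq (rcons s a) (a :: s) by rewrite perm_rcons.
rewrite map_rcons board_rcons (mprod_perm _ _ pr) mprod_cons // mulrC.
congr (_ * _).
  rewrite size_map -cats1 count_cat /= ltnn /= !addn0.
  have -> : size s = (count_mem a s + count (gtn a) s)%N.
    rewrite -[LHS](count_predC (pred1 a)); congr (_ + _)%N.
    apply: eq_in_count => k /(allP sle) /= ka.
    by rewrite ltn_neqAle ka andbT.
  by rewrite exprD mulrA mulfK // expf_neq0.
rewrite -IHs //; congr board_prod; apply/eq_in_map => k ks.
have /= ka := allP sle k ks.
by rewrite -cats1 count_cat /= ltnNge ka /= !addn0.
Qed.

(** * Comparing the two distributions *)

Section TriangularSystem.
Variables (F : fieldType) (q : F).
Hypothesis q_neq0 : q != 0.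
Hypothesis q_exp : forall k, (0 < k)%N -> q ^+ k != 1.

Lemma sum_split_values (T : eqType) n (L : seq T) (e : T -> nat)
    (wt : T -> F) (f : nat -> F) :
  {in L, forall w, (e w <= n)%N} ->
  \sum_(w <- L) wt w * f (e w)
  = \sum_(i < n.+1) (\sum_(w <- L | e w == i) wt w) * f i.
Proof.
move=> en; under [RHS]eq_bigr do rewrite big_distrl big_mkcond /=.
rewrite exchange_big /=; apply: eq_big_seq => w /en; rewrite -ltnS => lt_en.
rewrite (bigD1 (Ordinal lt_en)) //= eqxx big1 ?addr0 // => i.
by rewrite -val_eqE /= eq_sym => /negbTE->.
Qed.

(** At [x = i] the terms of larger value vanish by [qpoch_eq0] and those of smaller value by
    induction; value [i] has the nonzero coefficient [qpoch q n 1]. *)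
Lemma qpoch_sum_inj (T : eqType) n (L : seq T) (e1 e2 : T -> nat) (wt1 wt2 : T -> F) :
  {in L, forall w, (e1 w <= n)%N} -> {in L, forall w, (e2 w <= n)%N} ->
  (forall x, \sum_(w <- L) wt1 w * qpoch q n (q ^+ x / q ^+ e1 w)
           = \sum_(w <- L) wt2 w * qpoch q n (q ^+ x / q ^+ e2 w)) ->
  forall i, \sum_(w <- L | e1 w == i) wt1 w = \sum_(w <- L | e2 w == i) wt2 w.
Proof.
move=> en1 en2 H i; have [le_in|lt_ni] := leqP i n; last first.
  by rewrite !big1_seq // => w /andP[/eqP ei]; [move=> /en2|move=> /en1];
    rewrite ei leqNgt lt_ni.
pose D i := \sum_(w <- L | e1 w == i) wt1 w - \sum_(w <- L | e2 w == i) wt2 w.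
have HD x : \sum_(i < n.+1) D i * qpoch q n (q ^+ x / q ^+ i) = 0.
  under eq_bigr do rewrite mulrBl.
  pose f i := qpoch q n (q ^+ x / q ^+ i).
  rewrite sumrB -(sum_split_values wt1 f en1) -(sum_split_values wt2 f en2).
  by rewrite H subrr.
suff: D i = 0 by move/eqP; rewrite subr_eq0 => /eqP.
have [m] := ubnP i; elim: m => // m IHm in i le_in *; rewrite ltnS => le_im.
have := HD i; rewrite (bigD1 (Ordinal (le_in : (i < n.+1)%N))) //= big1 => [|j].
  rewrite addr0 divff ?expf_neq0 // => /eqP; rewrite mulf_eq0.
  by rewrite (negbTE (qpoch1_neq0 _ q_exp)) orbF => /eqP.
rewrite -val_eqE /= neq_ltn => /orP[ji|ij].
  by rewrite IHm ?mul0r // ?(leq_trans ji) // -ltnS.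
by rewrite qpoch_eq0 ?mulr0 // ij /= (leq_trans _ (leq_addl i n)) // -ltnS.
Qed.

End TriangularSystem.

Definition letters_below (s : seq nat) (k : nat) : nat := count (gtn k) s.

(** The two MacMahon identities, taken at [x] and at [x.+1] because of the division by [q] in
    [exc_sum_prod], have the same product side. The triangular system then separates the values. *)
Lemma des_exc_weight (F : fieldType) (q : F) s i :
  q != 0 -> (forall k, (0 < k)%N -> q ^+ k != 1) -> sorted leq s ->
  \sum_(w <- permutations s | desq w == i) q ^+ majq w
  = \sum_(w <- permutations s | hits (letters_below s) w == i)
      q ^+ 'C(size s, 2) / q ^+ cinv (letters_below s) w.
Proof.
move=> q0 q1 ss; pose n := size s; pose b := letters_below s.
have [t st] : exists t, all (gtn t) s.
  exists (foldr maxn 0 s).+1%N; elim: (s) => //= a v IHv.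
  rewrite ltnS leq_maxl /=; apply/allP => c /(allP IHv).
  by rewrite /= !ltnS leq_max => ->; rewrite orbT.
apply: (qpoch_sum_inj q0 q1 (n := n)) => [w|w|x].
- rewrite mem_permutations /n => /perm_size <-.
  by case: w => [|a w]; [rewrite /desq big_geq | apply/ltnW/desq_lt].
- by rewrite mem_permutations /n => /perm_size <-; apply: hits_le.
have M0 : letter_qfact q t s != 0.
  apply/prodf_neq0 => k _; apply/prodf_neq0 => l _.
  by rewrite subr_eq0 eq_sym q1.
apply: (mulIf M0).
have := desmaj_sum_prod q0 x st (leqnn t).
rewrite /desmaj_sum (eq_big_seq (fun w => q ^+ majq w * qpoch q n (q ^+ x / q ^+ desq w))).
  move=> ->; transitivity (qpoch q n 1 * board_prod q (q ^+ x.+1) (map b s)).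
    rewrite (board_prod_before _ _ ss st) //; congr (_ * _); apply: eq_mprod => k l kt.
    by rewrite kt exprS [q ^+ x.+1]exprSr mulrA.
  have b_homo : {homo b : k1 k2 / (k1 <= k2)%N}.
    by move=> k1 k2 k12; apply: sub_count => c /= ck; apply: leq_trans k12.
  rewrite -(exc_sum_prod q0 x.+1 ss st b_homo (fun k => count_size _ _)).
  rewrite mulrAC mulrC [RHS]mulrC; congr (_ * _).
  rewrite /exc_sum big_distrr /=; apply: eq_bigr => w _; rewrite exprSr mulfK // -/n.
  by rewrite mulrAC -mulrA.
move=> w; rewrite mem_permutations => wp; rewrite /desmaj_wt (perm_size wp) -/n.
suff -> : last_ge t w = false by rewrite mul0n !addn0.
rewrite /last_ge; case: w wp => // a w wp; apply/negbTE; rewrite -ltnNge.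
have /allP : all (gtn t) (a :: w) by rewrite (perm_all _ wp).
by apply; rewrite /= mem_last.
Qed.

(** The indeterminate of the rational functions over [rat] serves as [q]. *)
Lemma tofracX_neq1 k : (0 < k)%N -> FracField.tofrac ('X : {poly rat}) ^+ k != 1.
Proof.
move=> k0; rewrite -tofracXn -tofrac1 tofrac_eq.
apply/eqP => /(congr1 (fun p : {poly rat} => size p)); rewrite size_polyXn size_poly1.
by case=> k1; rewrite k1 in k0.
Qed.

Lemma coef_sum_polyXn (T : Type) (L : seq T) (P : pred T) (e : T -> nat) j :
  (\sum_(w <- L | P w) 'X^(e w) : {poly rat})`_j
  = (count (fun w => P w && (e w == j)) L)%:R.
Proof.
rewrite coef_sum -sum1_count natr_sum [RHS]big_mkcondr /=.
by apply: eq_bigr => w _; rewrite coefXn eq_sym; case: (_ == _).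
Qed.

(** Multiplication by ['X^N], with [N] at least every [cinv], turns the equality of weights into one
    of polynomials, whose coefficients are the counts. *)
Lemma des_exc_count s i (m : int) : sorted leq s ->
  count (fun w => (desq w == i) && ((majq w)%:Z == m)) (permutations s)
  = count (fun w => (hits (letters_below s) w == i) &&
      ('C(size s, 2)%:Z - (cinv (letters_below s) w)%:Z == m)) (permutations s).
Proof.
move=> ss; pose b := letters_below s; pose n := 'C(size s, 2).
pose N := (\sum_(w <- permutations s) cinv b w)%N.
have Nw w : w \in permutations s -> (cinv b w <= N)%N.
  by move=> wp; rewrite /N (big_rem w wp) leq_addr.
pose X := FracField.tofrac ('X : {poly rat}).
have X0 : X != 0 by rewrite tofrac_eq0 polyX_eq0.
have E : \sum_(w <- permutations s | desq w == i) 'X^(N + majq w)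
    = \sum_(w <- permutations s | hits b w == i) 'X^(N + n - cinv b w) :> {poly rat}.
  apply/eqP; rewrite -tofrac_eq !raddf_sum /=; apply/eqP.
  transitivity (X ^+ N * \sum_(w <- permutations s | desq w == i) X ^+ majq w).
    by rewrite big_distrr; apply: eq_bigr => w _; rewrite tofracXn exprD.
  rewrite (des_exc_weight i X0 tofracX_neq1 ss) big_distrr big_seq_cond [RHS]big_seq_cond /=.
  apply: eq_bigr => w /andP[wp _]; rewrite tofracXn mulrA -exprD.
  apply: (mulIf (expf_neq0 (cinv b w) X0)).
  by rewrite divfK ?expf_neq0 // -exprD subnK // (leq_trans (Nw w wp)) // leq_addr.
have {}E j : count (fun w => (desq w == i) && (N + majq w == j)%N) (permutations s)
    = count (fun w => (hits b w == i) && (N + n - cinv b w == j)%N) (permutations s).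
  apply/eqP; rewrite -(Num.Theory.eqr_nat rat) -!coef_sum_polyXn; apply/eqP.
  by rewrite E.
case mN: (m + N%:Z) => [j|j].
  rewrite (eq_count (a2 := fun w => (desq w == i) && (N + majq w == j)%N)) => [|w].
    rewrite E; apply: eq_in_count => w /Nw; rewrite -/b -/n => Nw'.
    by congr (_ && _); lia.
  by congr (_ && _); lia.
(* When [m + N] is negative, no word on either side takes the value [m]. *)
rewrite (eq_count (a2 := xpred0)) => [|w]; last by apply/negbTE/nandP; right; lia.
rewrite count_pred0; apply/esym/eqP; rewrite -leqn0 leqNgt -has_count.
by apply/hasPn => w /Nw; rewrite -/b -/n => Nw'; apply/nandP; right; lia.
Qed.

(** * Words over ['I_t] as sequences of numbers *)

Section Words.
Variables (n t : nat) (w : n.-tuple 'I_t).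
Implicit Types i : 'I_n.

Let W : seq nat := map val w.

Lemma size_val_word : size W = n. Proof. by rewrite size_map size_tuple. Qed.

Lemma nth_val_word i : nth 0%N W i = tnth w i.
Proof. by rewrite (nth_map (tnth w i)) ?size_tuple // -tnth_nth. Qed.

Lemma card_set_sum (P : pred 'I_n) : #|[set i | P i]| = (\sum_(i < n) P i)%N.
Proof. by rewrite -sum1dep_card big_mkcond. Qed.

Lemma in_descents i :
  (i \in descents (tnth w)) = (i.+1 < n)%N && (nth 0 W i.+1 < nth 0 W i)%N.
Proof.
rewrite inE; apply/existsP/andP => [[j /andP[/eqP ji jw]]|[lt_in iw]].
  by rewrite -ji -[in X in (X < _)%N]/(nat_of_ord j) !nth_val_word ltn_ord.
by exists (Ordinal lt_in); rewrite eqxx -!nth_val_word.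
Qed.

Lemma sum_descents (g : nat -> nat) :
  (\sum_(i < n | i \in descents (tnth w)) g i =
   \sum_(0 <= i < n.-1) (nth 0 W i.+1 < nth 0 W i) * g i)%N.
Proof.
rewrite (eq_bigl (fun i : 'I_n => (i.+1 < n)%N && (nth 0 W i.+1 < nth 0 W i)%N));
  last by move=> i; apply: in_descents.
case: n size_val_word w => [|n'] sW w'; first by rewrite big_ord0 big_geq.
rewrite big_mkcond big_ord_recr /= ltnn addn0 big_mkord; apply: eq_bigr => i _.
by rewrite ltnS ltn_ord /=; case: (_ < _)%N; rewrite ?mul1n.
Qed.

Lemma des_word : des (tnth w) = desq W.
Proof.
rewrite /des /desq -sum1_card (sum_descents (fun=> 1%N)) size_val_word.
by apply: eq_bigr => i _; rewrite muln1.
Qed.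

Lemma maj_word : maj (tnth w) = majq W.
Proof. by rewrite /maj /majq (sum_descents S) size_val_word. Qed.

End Words.

(** The letters below [k] fill an initial segment of a sorted word. This turns excedances into
    hits. *)
Lemma nth_lt_count s k i : sorted leq s -> (i < size s)%N ->
  (nth 0 s i < k)%N = (i < letters_below s k)%N.
Proof.
elim: s i => //= a s IHs i ps; rewrite /letters_below /=.
have [ak|ka] := ltnP a k; first by case: i => //= i si; rewrite IHs ?(path_sorted ps).
have sa : all (leq a) s by apply: order_path_min ps; apply: leq_trans.
rewrite add0n (_ : count _ _ = 0%N); last first.
  apply/eqP; rewrite -leqn0 leqNgt -has_count; apply/hasPn => c /(allP sa) /= ac.
  by rewrite -leqNgt (leq_trans ka).
case: i => [_|i si] /=; first by rewrite ltnNge ka.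
by rewrite ltnNge (leq_trans ka) // (allP sa) // mem_nth.
Qed.

(** * Excedances and [statx] on the words of a multiset *)

Section MultisetWords.
Variables (t : nat) (v : 'I_t -> nat).
Let n := wsize v.
Let f0 : seq nat := map val (fword v).

Lemma fword_val_sorted : sorted leq f0.
Proof. by rewrite sorted_map; apply: fword_sorted. Qed.

Lemma before_letters (k : 'I_t) : before v k = letters_below f0 k.
Proof.
rewrite /letters_below count_map count_flatten -map_comp sumnE big_map big_enum /=.
rewrite /before big_mkcond; apply: eq_bigr => l _ /=.
by rewrite count_nseq /=; case: (_ < _)%N; rewrite ?mul1n ?mul0n.
Qed.

Lemma exc_threshold (k : 'I_t) (i : 'I_n) :
  (tnth (fword v) i < k)%N = (i < letters_below f0 k)%N.
Proof.
rewrite -nth_val_word nth_lt_count ?fword_val_sorted //.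
by rewrite size_val_word.
Qed.

Lemma exc_word (w : n.-tuple 'I_t) :
  exc (tnth (fword v)) (tnth w) = hits (letters_below f0) (map val w).
Proof.
rewrite /exc card_set_sum /hits size_val_word; apply: eq_bigr => i _.
by rewrite exc_threshold nth_val_word.
Qed.

(** The predecessors of [i] are counted by its rank; without those carrying a smaller letter they
    number [c i]. At an excedance the predecessors are the positions before [i]. Otherwise those
    with smaller letters form the two sets in [statx], after [i] and below the threshold. *)
Lemma statx_word (w : n.-tuple 'I_t) :
  statx w = 'C(n, 2)%:Z - (cinv (letters_below f0) (map val w))%:Z.
Proof.
pose c (i : 'I_n) := (\sum_(m < n) (prec (before v (tnth w i)) m i
                                   && (tnth w i <= tnth w m)))%N.
have -> : cinv (letters_below f0) (map val w) = (\sum_(i < n) c i)%N.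
  rewrite /cinv size_val_word; apply: eq_bigr => i _; apply: eq_bigr => m _.
  by rewrite !nth_val_word before_letters.
have -> : (\sum_(i < n) c i)%N%:Z = \sum_(i < n) (c i)%:Z.
  exact: (big_morph Posz PoszD (erefl _)).
rewrite (bigID (fun i : 'I_n => tnth w i <= tnth (fword v) i)%N) /=.
under [X in _ = _ - (_ + X)]eq_bigl do rewrite -ltnNge.
rewrite /statx -/n.
set S1 := \sum_(i < n | _) (_ + _); set S2 := \sum_(i < n | _) _.
set S3 := \sum_(i < n | _) (_ - _); set S4 := \sum_(i < n | _) (_ + _).
set S5 := \sum_(i < n | _) _; set S6 := \sum_(i < n | _) _.
have -> : S5 = S4 - S1.
  rewrite /S4 /S1 -sumrB; apply: eq_bigr => i.
  rewrite leqNgt exc_threshold -before_letters -leqNgt => Bi; rewrite !card_set_sum.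
  set B := before v _ in Bi *.
  have := prec_count (ltn_ord i) (leq_trans Bi (ltnW (ltn_ord i))).
  rewrite /prec_rank ltnNge Bi /= => cnt.
  have : (c i + \sum_(j < n) ((i < j) && (tnth w j < tnth w i))
     + \sum_(m < n) ([&& m < i, m.+1 <= B & tnth w m < tnth w i]) = B + (n - i.+1))%N.
    rewrite -cnt -!big_split /=; apply: eq_bigr => m _; rewrite -/B.
    by rewrite /prec; lia.
  move: (c i) (\sum_(j < n) _)%N (\sum_(m < n) _)%N (ltn_ord i) => ci x1 x2 lt_in; lia.
have -> : S6 = S3 - S2.
  rewrite /S3 /S2 -sumrB; apply: eq_bigr => i.
  rewrite exc_threshold -before_letters => iB; rewrite !card_set_sum.
  set B := before v _ in iB *.
  have : (c i + \sum_(m < n) ((m < i) && (tnth w m < tnth w i)) = i)%N.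
    have Bn : (B <= n)%N.
      by rewrite /B before_letters (leq_trans (count_size _ _)) // size_val_word.
    have := prec_count (ltn_ord i) Bn; rewrite /prec_rank iB => cnt; rewrite -[RHS]cnt.
    rewrite -big_split /=; apply: eq_bigr => m _; rewrite -/B.
    by rewrite /prec; lia.
  move: (c i) (\sum_(m < n) ((m < i) && (tnth w m < tnth w i)))%N => ci x1; lia.
ring.
Qed.

Lemma permutations_words :
  perm_eq (permutations f0) [seq map val w | w : n.-tuple 'I_t in words v].
Proof.
apply: uniq_perm; first exact: permutations_uniq.
  rewrite map_inj_uniq ?enum_uniq // => w1 w2 e.
  by apply/val_inj/(inj_map val_inj).
move=> s; rewrite mem_permutations; apply/idP/mapP => [sf|[w]]; last first.
  rewrite mem_enum => wv ->; apply/perm_map/allP => k _ /=; apply/eqP.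
  move: wv (fword_in_words v); rewrite !inE => /forallP/(_ k)/eqP->.
  by move=> /forallP/(_ k)/eqP->.
(* A rearrangement of the values is lifted to ['I_t] by rearranging the positions of [fword]. *)
have [I pI sE] := perm_iotaP 0%N sf; rewrite size_val_word in pI.
have sI : size I == n by rewrite (perm_size pI) size_iota.
have I_lt i : (i < n)%N -> (nth 0 I i < n)%N.
  move=> lt_in; have: nth 0%N I i \in I by rewrite mem_nth // (eqP sI).
  by rewrite (perm_mem pI) mem_iota.
pose w : n.-tuple 'I_t := [tuple tnth (fword v) (Ordinal (I_lt i (ltn_ord i))) | i < n].
have wE : s = map val w.
  apply: (@eq_from_nth _ 0%N) => [|i].
    by rewrite (size_val_word w) sE size_map (eqP sI).
  rewrite sE size_map (eqP sI) => lt_in.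
  rewrite (nth_map 0%N) ?(eqP sI) // (nth_val_word w (Ordinal lt_in)) tnth_mktuple.
  by rewrite -nth_val_word.
exists w => //; rewrite mem_enum inE; apply/forallP => k; apply/eqP.
clearbody w; move/seq.permP: sf => /(_ (pred1 (val k))); rewrite wE !count_map => cE.
move: (fword_in_words v); rewrite inE => /forallP/(_ k)/eqP<-.
have valE (u : seq 'I_t) : count_mem k u = count (preim val (pred1 (val k))) u.
  exact: eq_count.
by rewrite !valE cE.
Qed.

Lemma card_words (P : pred (seq nat)) :
  #|[set w in words v | P (map val w)]| = count P (permutations f0).
Proof.
rewrite (seq.permP permutations_words) count_map -sum1_count big_enum_cond /=.
by rewrite -sum1dep_card.
Qed.

Lemma words_equidistributed :
  jointly_distributed (words v)
    (fun w => exc (tnth (fword v)) (tnth w)) (fun w => statx w)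
    (fun w => des (tnth w)) (fun w => (maj (tnth w))%:Z).
Proof.
move=> k m; have := des_exc_count k m fword_val_sorted.
rewrite size_val_word -/f0 -/n -!card_words => E.
transitivity #|[set w in words v |
    (desq (map val w) == k) && ((majq (map val w))%:Z == m)]|.
  by rewrite E; apply: eq_card => w; rewrite !inE exc_word statx_word.
by apply: eq_card => w; rewrite !inE des_word maj_word.
Qed.

End MultisetWords.

(** Equal joint counts mean that the two lists of pairs of values are permutations of each other. *)
Lemma jointly_distributed_sum (T : finType) (A : {set T}) (x x' : T -> nat)
    (y y' : T -> int) (V : nmodType) (g : nat -> int -> V) :
  jointly_distributed A x y x' y' ->
  \sum_(s in A) g (x s) (y s) = \sum_(s in A) g (x' s) (y' s).
Proof.
move=> H.
have sumE (z : T -> nat) (u : T -> int) : \sum_(s in A) g (z s) (u s)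
    = \sum_(km <- [seq (z s, u s) | s <- enum A]) g km.1 km.2.
  by rewrite big_map big_enum.
rewrite !sumE; apply/perm_big/allP => -[k m] _ /=; apply/eqP.
have countE (z : T -> nat) (u : T -> int) :
    count_mem (k, m) [seq (z s, u s) | s <- enum A]
    = #|[set s in A | (z s == k) && (u s == m)]|.
  by rewrite count_map -sum1_count big_enum_cond /= -sum1dep_card.
by rewrite !countE H.
Qed.

(** * The statistics on permutations *)

Section Permutations.
Variable n : nat.
Implicit Types s : 'S_n.

Definition pword s : seq nat := [seq val (s i) | i <- enum 'I_n].

Lemma size_pword s : size (pword s) = n.
Proof. by rewrite size_map size_enum_ord. Qed.

Lemma nth_pword s (i : 'I_n) : nth 0%N (pword s) i = s i.
Proof. by rewrite (nth_map i) ?size_enum_ord // nth_ord_enum. Qed.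

Lemma pwordE s : pword s = map val [tuple s i | i < n].
Proof. exact: (map_comp val s). Qed.

Lemma eq_descents s : descents s = descents (tnth [tuple s i | i < n]).
Proof.
by apply/setP => i; rewrite !inE; apply: eq_existsb => j; rewrite !tnth_mktuple.
Qed.

Lemma des_perm s : des s = desq (pword s).
Proof. by rewrite /des eq_descents pwordE -des_word. Qed.

Lemma maj_perm s : maj s = majq (pword s).
Proof. by rewrite /maj eq_descents pwordE -maj_word. Qed.

(** [pword] is injective into the arrangements of [iota 0 n], and both sides have [n!] elements. *)
Lemma card_permutations (P : pred (seq nat)) :
  #|[set s | P (pword s)]| = count P (permutations (iota 0 n)).
Proof.
have iotaE : map val (enum 'I_n) = iota 0 n by rewrite val_enum_ord.
have pw : perm_eq [seq pword s | s <- enum 'S_n] (permutations (iota 0 n)).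
  have inj : injective pword.
    move=> s1 s2 e; apply/permP => i; apply/val_inj.
    by rewrite /= -!nth_pword e.
  have u : uniq [seq pword s | s <- enum 'S_n] by rewrite map_inj_uniq ?enum_uniq.
  have sub : {subset [seq pword s | s <- enum 'S_n] <= permutations (iota 0 n)}.
    move=> _ /mapP[s _ ->]; rewrite mem_permutations -iotaE /pword (map_comp val).
    apply/perm_map/uniq_perm; [|exact: enum_uniq|move=> i].
      by rewrite map_inj_uniq ?enum_uniq //; apply: perm_inj.
    rewrite mem_enum; apply/mapP; exists (s^-1%g i); rewrite ?mem_enum //.
    by rewrite permKV.
  have le : (size (permutations (iota 0 n)) <= size [seq pword s | s <- enum 'S_n])%N.
    rewrite size_permutations ?iota_uniq // size_iota size_map -cardE.
    by rewrite card_Sn.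
  have [_ eqm] := uniq_min_size u sub le.
  exact: uniq_perm u (permutations_uniq _) eqm.
rewrite -(seq.permP pw) count_map -sum1_count big_enum_cond /=.
by rewrite -sum1dep_card.
Qed.

End Permutations.

(** * Reverse-complementation, and the relation of [stat] to [cinv] *)

Section PermutationStatistics.
Variable n : nat.
Implicit Types s : 'S_n.

Definition rev_perm : 'S_n := perm (@rev_ord_inj n).

Definition rev_compl s : 'S_n := (rev_perm * s * rev_perm)%g.

Lemma rev_complE s i : rev_compl s i = rev_ord (s (rev_ord i)).
Proof. by rewrite !permM !permE. Qed.

Lemma rev_complK : involutive rev_compl.
Proof. by move=> s; apply/permP => i; rewrite !rev_complE !rev_ordK. Qed.

(** Reverse-complementation moves a descent from position [i] to [n - 2 - i], counted from 0. *)
Lemma sum_descents_rev s (g : nat -> nat) :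
  (\sum_(0 <= i < n.-1)
     (nth 0 (pword (rev_compl s)) i.+1 < nth 0 (pword (rev_compl s)) i) * g i
   = \sum_(0 <= i < n.-1)
       (nth 0 (pword s) i.+1 < nth 0 (pword s) i) * g (n.-1 - i.+1))%N.
Proof.
rewrite big_nat_rev /= add0n; apply: eq_big_nat => i /andP[_ ilt].
congr (nat_of_bool _ * _)%N.
have i0 : (i < n)%N by lia.
have i1 : (i.+1 < n)%N by lia.
have r0 : (n.-1 - i.+1 < n)%N by lia.
have r1 : ((n.-1 - i.+1).+1 < n)%N by lia.
rewrite (nth_pword _ (Ordinal i0)) (nth_pword _ (Ordinal i1)).
rewrite (nth_pword _ (Ordinal r0)) (nth_pword _ (Ordinal r1)) !rev_complE /=.
have -> : rev_ord (Ordinal r0) = Ordinal i1 by apply: val_inj => /=; lia.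
have -> : rev_ord (Ordinal r1) = Ordinal i0 by apply: val_inj => /=; lia.
by have := ltn_ord (s (Ordinal i0)); have := ltn_ord (s (Ordinal i1)); lia.
Qed.

Lemma des_rev_compl s : des (rev_compl s) = des s.
Proof.
rewrite !des_perm /desq !size_pword.
have := sum_descents_rev s (fun=> 1%N).
by under eq_bigr do rewrite muln1; under [RHS]eq_bigr do rewrite muln1.
Qed.

Lemma maj_rev_compl s : (maj (rev_compl s) + maj s = n * des s)%N.
Proof.
rewrite !maj_perm des_perm /majq /desq !size_pword (sum_descents_rev s S).
rewrite -big_split big_distrr /=; apply: eq_big_nat => i ilt.
by rewrite -mulnDr mulnC; congr (_ * _)%N; lia.
Qed.

Lemma card_des_maj_sym k (m : int) :
  #|[set s : 'S_n | (des s == k) && ((maj s)%:Z == m)]|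
  = #|[set s : 'S_n | (des s == k) && ((maj s)%:Z == (n * k)%:Z - m)]|.
Proof.
rewrite -[RHS](card_imset _ (inv_inj rev_complK)).
rewrite (can2_imset_pre _ rev_complK rev_complK); apply: eq_card => s.
rewrite !inE des_rev_compl; have [<-|//] := eqVneq (des s) k.
by have := maj_rev_compl s; move: (n * des s)%N => N; lia.
Qed.

Lemma letters_below_iota (k : 'I_n) : letters_below (iota 0 n) k = k.
Proof.
suff H N : letters_below (iota 0 N) k = minn N k by rewrite H; apply/minn_idPr/ltnW.
rewrite /letters_below; elim: N => [|N IHN]; first by rewrite min0n.
by rewrite -addn1 iotaD count_cat IHN /= add0n addn0; lia.
Qed.

Lemma exc_perm s : exc id s = hits (letters_below (iota 0 n)) (pword s).
Proof.
rewrite /exc card_set_sum /hits size_pword; apply: eq_bigr => i _.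
by rewrite nth_pword letters_below_iota.
Qed.

Lemma sum_between a b : (b <= n)%N -> (\sum_(k < n) (a < k < b) = b - a.+1)%N.
Proof.
move=> bn; suff H N : (\sum_(k < N) (a < k < b) = minn b N - a.+1)%N.
  by rewrite H (minn_idPl bn).
elim: N => [|N IHN]; first by rewrite big_ord0 minn0.
by rewrite big_ord_recr /= IHN; lia.
Qed.

Lemma card_pairs_sum (P : 'I_n -> 'I_n -> bool) :
  #|[set ij : 'I_n * 'I_n | P ij.1 ij.2]| = (\sum_(i < n) \sum_(j < n) P i j)%N.
Proof. by rewrite pair_bigA /= -sum1dep_card big_mkcond. Qed.

(** Position by position, [stat] and [cinv] differ by a simple term and by [g (s i)], the number of
    [m] with [m < s i < s m]. Summed over all values, [g] gives the sum of [s m - m.+1], where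
    truncated subtraction leaves only excedances. *)
Lemma stat_cinv s :
  stat s + ('C(n, 2)%:Z - (cinv (letters_below (iota 0 n)) (pword s))%:Z)
  = (n * exc id s)%:Z.
Proof.
pose a (i : 'I_n) := (\sum_(m < n) [&& m < i, s i < s m & i < s i])%N.
pose d (i : 'I_n) := (\sum_(m < n) [&& i < m, s i <= m & s i < s m])%N.
pose c (i : 'I_n) := (\sum_(m < n) (prec (s i) m i && (s i <= s m)))%N.
pose g (k : 'I_n) := (\sum_(m < n) (m < k < s m))%N.
have PS (F : 'I_n -> nat) : (\sum_(i < n) F i)%N%:Z = \sum_(i < n) (F i)%:Z.
  exact: (big_morph Posz PoszD (erefl _)).
have cE : cinv (letters_below (iota 0 n)) (pword s) = (\sum_(i < n) c i)%N.
  rewrite /cinv size_pword; apply: eq_bigr => i _; apply: eq_bigr => m _.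
  by rewrite !nth_pword letters_below_iota.
have aE : #|[set ij : 'I_n * 'I_n |
    [&& ij.1 < ij.2, s ij.2 < s ij.1 & ij.2 < s ij.2]%N]| = (\sum_(i < n) a i)%N.
  rewrite (card_pairs_sum (fun i j : 'I_n => [&& i < j, s j < s i & j < s j]%N)).
  exact: exchange_big.
have dE : #|[set ij : 'I_n * 'I_n |
    [&& ij.1 < ij.2, s ij.1 <= ij.2 & s ij.1 < s ij.2]%N]| = (\sum_(i < n) d i)%N.
  exact: (card_pairs_sum (fun i j : 'I_n => [&& i < j, s i <= j & s i < s j]%N)).
have reidx (F : 'I_n -> nat) : (\sum_(i < n) F (s i) = \sum_(i < n) F i)%N.
  by rewrite [RHS](reindex_inj (@perm_inj _ s)).
have gE : (\sum_(i < n) g (s i) = \sum_(m < n) (s m - m.+1))%N.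
  rewrite (reidx g) /g exchange_big /=.
  by apply: eq_bigr => m _; apply: sum_between; apply: ltnW.
have sE : (\sum_(i < n) s i = 'C(n, 2))%N.
  by rewrite (reidx (fun i => val i)) -bin2_sum big_mkord.
have above i : (\sum_(m < n) (s i < s m) = n - (s i).+1)%N.
  rewrite (reidx (fun m => nat_of_bool (s i < m)%N)).
  rewrite -(sum_between (s i) (leqnn n)); apply: eq_bigr => m _.
  by rewrite ltn_ord andbT.
have s_inj (i m : 'I_n) : (i != m :> nat) -> (s i != s m :> nat).
  by apply: contraNneq => /val_inj/perm_inj ->.
(* At an excedance [a i = c i], and the larger letters split into [d i] and [g (s i)] according to
   whether their positions reach [s i]. Elsewhere [a i = 0] and [c i = g (s i) + d i]. *)
have term (i : 'I_n) : (if (i < s i)%N then (s i)%:Z - i%:Z else - (s i)%:Z)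
    + (a i)%:Z + (d i)%:Z - (c i)%:Z
    = (if (i < s i)%N then n%:Z - 1 - i%:Z else - (s i)%:Z) - (g (s i))%:Z.
  case: ltnP => [isi|sii].
    have -> : a i = c i.
      apply: eq_bigr => m _; rewrite /prec isi.
      by have [->|/s_inj] := eqVneq (m : nat) i; lia.
    have : (d i + g (s i) = n - (s i).+1)%N.
      rewrite -above -big_split; apply: eq_bigr => m _ /=.
      lia.
    by have := ltn_ord (s i); move: (d i) (g (s i)) (c i) => ? ? ?; lia.
  have -> : a i = 0%N by apply: big1 => m _; lia.
  have -> : c i = (g (s i) + d i)%N.
    rewrite -big_split; apply: eq_bigr => m _ /=; rewrite /prec.
    by have [->|/s_inj] := eqVneq (m : nat) i; lia.
  by rewrite PoszD; ring.
have excE : (n * exc id s)%N%:Z = \sum_(i < n) (if (i < s i)%N then n%:Z else 0).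
  rewrite /exc card_set_sum big_distrr PS; apply: eq_bigr => i _ /=.
  by case: ifP; rewrite ?muln1 ?muln0.
have statE : stat s = \sum_(i < n) (if (i < s i)%N then (s i)%:Z - i%:Z else - (s i)%:Z)
    + \sum_(i < n) (a i)%:Z + \sum_(i < n) (d i)%:Z.
  rewrite /stat aE dE !PS; congr (_ + _ + _).
  rewrite [X in X + _]big_mkcond [X in _ + X]big_mkcond -big_split /=.
  by apply: eq_bigr => i _; case: ltnP => _; lia.
rewrite statE cE -sE !PS excE.
transitivity (\sum_(i < n) (s i)%:Z + \sum_(i < n)
   ((if (i < s i)%N then (s i)%:Z - i%:Z else - (s i)%:Z) + (a i)%:Z + (d i)%:Z - (c i)%:Z)).
  by rewrite !big_split /= sumrN; ring.
rewrite [X in _ + X](eq_bigr _ (fun i _ => term i)).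
rewrite big_split /= sumrN -(PS (fun i => g (s i))) gE PS addrA -big_split -sumrB /=.
by apply: eq_bigr => i _; case: ltnP => isi; have := ltn_ord (s i); lia.
Qed.

End PermutationStatistics.

(** For [k] excedances, [stat_cinv] turns [stat = m] into the value [n k - m] of the statistic
    equidistributed with [maj]; reverse-complementation then replaces [n k - m] by [m]. *)
Lemma permutations_equidistributed n :
  jointly_distributed [set: 'S_n]
    (fun s => exc id s) (fun s => stat s)
    (fun s => des s) (fun s => (maj s)%:Z).
Proof.
move=> k m; pose m' := (n * k)%:Z - m.
pose b := letters_below (iota 0 n).
have := des_exc_count k m' (iota_sorted 0 n); rewrite size_iota -!card_permutations => E.
transitivity #|[set s : 'S_n | (hits b (pword s) == k)
                 && ('C(n, 2)%:Z - (cinv b (pword s))%:Z == m')]|.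
  apply: eq_card => s; rewrite !inE -exc_perm; have [ek|//] := eqVneq (exc id s) k.
  have := stat_cinv s; rewrite -/b /m' ek.
  by move: (stat s) ('C(n, 2)%:Z - _) => x y; lia.
rewrite -E; transitivity #|[set s : 'S_n | (des s == k) && ((maj s)%:Z == m')]|.
  by apply: eq_card => s; rewrite !inE des_perm maj_perm.
by rewrite -card_des_maj_sym; apply: eq_card => s; rewrite !inE.
Qed.

Theorem theorem5 :
  (forall n : nat, (0 < n)%N ->
     jointly_distributed [set: 'S_n]
       (fun s => exc id s) (fun s => stat s)
       (fun s => des s) (fun s => (maj s)%:Z)
     /\
     forall (R : comUnitRingType) (p q : R), q \is a GRing.unit ->
       \sum_(s : 'S_n) p ^+ exc id s * q ^ stat s
       = \sum_(s : 'S_n) p ^+ des s * q ^+ maj s)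
  /\
  (forall (t : nat) (v : 'I_t -> nat),
     jointly_distributed (words v)
       (fun w => exc (tnth (fword v)) (tnth w)) (fun w => statx w)
       (fun w => des (tnth w)) (fun w => (maj (tnth w))%:Z)
     /\
     forall (R : comUnitRingType) (p q : R), q \is a GRing.unit ->
       \sum_(w in words v) p ^+ exc (tnth (fword v)) (tnth w) * q ^ statx w
       = \sum_(w in words v) p ^+ des (tnth w) * q ^+ maj (tnth w)).
Proof.
split=> [n _|t v].
  split=> [|R p q _]; first exact: permutations_equidistributed.
  have setTE (G : 'S_n -> R) : \sum_s G s = \sum_(s in [set: 'S_n]) G s.
    by apply: eq_bigl => s; rewrite inE.
  rewrite !setTE.
  exact: (jointly_distributed_sum (fun k m => p ^+ k * q ^ m)
    (@permutations_equidistributed n)).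
split=> [|R p q _]; first exact: words_equidistributed.
exact: (jointly_distributed_sum (fun k m => p ^+ k * q ^ m) (@words_equidistributed t v)).
Qed.
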